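(* For every non-empty set $X$, the free object on $X$ in the category of commutative skew braces is residually finite.
   Context: A (left) skew brace is a triple $(B,+,\circ)$ with $(B,+)$ and $(B,\circ)$ groups such that $a\circ(b+c)=a\circ b-a+a\circ c$ for all $a,b,c$. It is called commutative if $(B,\circ)$ is abelian ($(B,+)$ need not be abelian). Put $\lambda_a(b)=-a+a\circ b$. An ideal of $B$ is a subset $I$ that is a normal subgroup of $(B,+)$ and of $(B,\circ)$ with $\lambda_b(I)=I$ for all $b\in B$. $B$ is residually finite if the intersection of all ideals $I$ with $B/I$ finite is $\{0\}$. The free object on $X$ is a commutative skew brace $B$ with a map $i\colon X\to B$ such that each map from $X$ to a commutative skew brace $K$ factors as $\varphi\circ i$ for a unique homomorphism $\varphi\colon B\to K$; it exists. *)

(* Defs.v *)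
From mathcomp Require Import all_boot.
From mathcomp Require Import boolp classical_sets functions cardinality.

Set Implicit Arguments.
Unset Strict Implicit.
Unset Printing Implicit Defensive.

Local Open Scope classical_set_scope.

(* A skew brace carries two group structures on a single type, the additive one
   not being abelian in general, so neither [groupType] nor [zmodType] can
   supply both of them; hence this unbundled description of a group. *)
Record group_laws (T : Type) (op : T -> T -> T) (e : T) (inv : T -> T) : Prop :=
  GroupLaws {
    group_opA : associative op;
    group_op1l : left_id e op;
    group_op1r : right_id e op;
    group_opVl : left_inverse e inv op;
    group_opVr : right_inverse e inv op
  }.

Record normal_subgroup (T : Type) (op : T -> T -> T) (e : T) (inv : T -> T)
    (N : set T) : Prop := NormalSubgroup {
  normal_1 : N e;
  normal_op : forall x y, N x -> N y -> N (op x y);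
  normal_inv : forall x, N x -> N (inv x);
  normal_conj : forall g x, N x -> N (op (op g x) (inv g))
}.

(* The neutral elements [sb_zero] and [sb_one] are provably equal. *)
Record skewBrace : Type := SkewBrace {
  sb_sort :> Type;
  sb_add : sb_sort -> sb_sort -> sb_sort;
  sb_zero : sb_sort;
  sb_opp : sb_sort -> sb_sort;
  sb_circ : sb_sort -> sb_sort -> sb_sort;
  sb_one : sb_sort;
  sb_inv : sb_sort -> sb_sort;
  sb_add_group : group_laws sb_add sb_zero sb_opp;
  sb_circ_group : group_laws sb_circ sb_one sb_inv;
  sb_brace : forall a b c : sb_sort,
    sb_circ a (sb_add b c) =
    sb_add (sb_add (sb_circ a b) (sb_opp a)) (sb_circ a c)
}.

Declare Scope skew_brace_scope.
Delimit Scope skew_brace_scope with SB.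
Notation "x + y" := (sb_add x y) : skew_brace_scope.
Notation "- x" := (sb_opp x) : skew_brace_scope.
Notation "x ∘ y" := (sb_circ x y)
  (at level 40, left associativity) : skew_brace_scope.
Local Open Scope skew_brace_scope.

Definition commutative_skew_brace (B : skewBrace) : Prop :=
  commutative (@sb_circ B).

Definition sb_lambda (B : skewBrace) (a b : B) : B := - a + (a ∘ b).

Record is_ideal (B : skewBrace) (I : set B) : Prop := IsIdeal {
  ideal_add : normal_subgroup (@sb_add B) (@sb_zero B) (@sb_opp B) I;
  ideal_circ : normal_subgroup (@sb_circ B) (@sb_one B) (@sb_inv B) I;
  ideal_lambda : forall b : B, sb_lambda b @` I = I
}.

Definition sb_coset (B : skewBrace) (I : set B) (b : B) : set B :=
  (fun x : B => b + x) @` I.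

(* The underlying set of B/I. For an ideal I, the additive cosets b + I and the
   multiplicative cosets b ∘ I are the same sets. *)
Definition sb_quotient (B : skewBrace) (I : set B) : set (set B) :=
  range (sb_coset I).

Definition residually_finite (B : skewBrace) : Prop :=
  \bigcap_(I in [set I : set B | is_ideal I /\ finite_set (sb_quotient I)]) I
  = [set sb_zero B].

Record is_sb_hom (B K : skewBrace) (phi : B -> K) : Prop := IsSbHom {
  sb_hom_add : forall x y : B, phi (x + y) = phi x + phi y;
  sb_hom_circ : forall x y : B, phi (x ∘ y) = phi x ∘ phi y
}.

Definition is_free_commutative_skew_brace
    (X : Type) (B : skewBrace) (i : X -> B) : Prop :=
  commutative_skew_brace B /\
  forall K : skewBrace, commutative_skew_brace K ->
  forall f : X -> K,
  exists! phi : B -> K, is_sb_hom phi /\ f = phi \o i.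

(* Main.v *)
From HB Require Import structures.
From mathcomp Require Import all_boot all_algebra.
From mathcomp Require Import boolp classical_sets functions cardinality.
From mathcomp Require Import ring.
Require Import Defs.

(* Every commutative skew brace B embeds in an affine model over a commutative
   ring R: there are maps sigma, u from B to the units of R with
     sigma(a ∘ b) = sigma(a) sigma(b),  u(a ∘ b) = u(a + b) = u(a) u(b),
     sigma(a + b) = sigma(a) + u(a) (sigma(b) - 1),
   and (sigma, u) is injective. Indeed an Itô-type argument shows that B has an
   ideal M with (M,+) abelian and B/M trivial. Let s be a section of B -> B/M.
   The translations S_b : (a,y) -> (a ∘ b, y + b) and U_b : (a,y) -> (a, y + b)
   act by commuting operators on M-valued functions f(a,y) depending on y only
   modulo M, and the function omega(a,y) = s(y - a) + a - s(y) satisfies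
   (S_b omega - omega)(a,y) = s(y) + lambda_a(b) - s(y + b), a derivation in b
   that is injective on M. R is the bicommutant of the translations on the
   functions f for which S_(b+c) f = S_b f + U_b (S_c f - f), omega among them;
   there sigma(b) = S_b and u(b) = U_b.

   If B is generated by X, then sigma(w) and u(w) are quotients of integral
   polynomials in the sigma(x) and u(x), the same polynomials for all such
   representations. The pairs of units of Z/2^n form a finite commutative skew
   brace by the same formulas, and for free B its generators may be sent to
   arbitrary pairs of odd integers modulo 2^n. So if w dies in all finite
   quotients, numerator and denominator agree at all odd integers; hence they
   are equal as polynomials, so sigma(w) = u(w) = 1 in R and w = 0. *)

Set Implicit Arguments.
Unset Strict Implicit.
Unset Printing Implicit Defensive.

Import GRing.Theory Num.Theory.
Local Open Scope classical_set_scope.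

(** * Skew brace arithmetic *)

Section SkewBraceTheory.
Local Open Scope skew_brace_scope.
Variable B : skewBrace.
Implicit Types a b c x y z : B.

Let addG := sb_add_group B.
Let circG := sb_circ_group B.

Lemma sb_addA : associative (@sb_add B). Proof. exact: group_opA addG. Qed.
Lemma sb_add0 : left_id (sb_zero B) (@sb_add B).
Proof. exact: group_op1l addG. Qed.
Lemma sb_addr0 : right_id (sb_zero B) (@sb_add B).
Proof. exact: group_op1r addG. Qed.
Lemma sb_addN : left_inverse (sb_zero B) (@sb_opp B) (@sb_add B).
Proof. exact: group_opVl addG. Qed.
Lemma sb_subrr : right_inverse (sb_zero B) (@sb_opp B) (@sb_add B).
Proof. exact: group_opVr addG. Qed.
Lemma sb_addrK x y : x + y + - y = x.
Proof. by rewrite -sb_addA sb_subrr sb_addr0. Qed.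
Lemma sb_addrNK x y : x + - y + y = x.
Proof. by rewrite -sb_addA sb_addN sb_addr0. Qed.
Lemma sb_addIr z : injective (fun x => x + z).
Proof. by move=> x y /(congr1 (fun t => t + - z)); rewrite !sb_addrK. Qed.
Lemma sb_addrI z : injective (fun x => z + x).
Proof.
by move=> x y /(congr1 (fun t => - z + t)); rewrite !sb_addA sb_addN !sb_add0.
Qed.
Lemma sb_oppK : involutive (@sb_opp B).
Proof. by move=> x; apply: (@sb_addIr (- x)); rewrite sb_addN sb_subrr. Qed.
Lemma sb_oppD x y : - (x + y) = - y + - x.
Proof. by apply: (@sb_addIr (x + y)); rewrite sb_addN sb_addA sb_addrNK sb_addN. Qed.
Lemma sb_opp0 : - sb_zero B = sb_zero B.
Proof. by rewrite -[LHS]sb_addr0 sb_addN. Qed.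
Lemma sb_sub_eq0 x y : x + - y = sb_zero B -> x = y.
Proof. by move=> h; rewrite -(sb_addrNK x y) h sb_add0. Qed.

(* Rewriting with these rules decides equality of additive words: it computes
   left-associated reduced words of the free group. *)
Definition sb_word := (sb_addA, sb_oppD, sb_oppK, sb_opp0, sb_add0, sb_addr0,
  sb_addN, sb_subrr, sb_addrK, sb_addrNK).

Lemma sb_circA : associative (@sb_circ B). Proof. exact: group_opA circG. Qed.
Lemma sb_circ1 : left_id (sb_one B) (@sb_circ B).
Proof. exact: group_op1l circG. Qed.
Lemma sb_circr1 : right_id (sb_one B) (@sb_circ B).
Proof. exact: group_op1r circG. Qed.
Lemma sb_circV : left_inverse (sb_one B) (@sb_inv B) (@sb_circ B).
Proof. exact: group_opVl circG. Qed.
Lemma sb_circrV : right_inverse (sb_one B) (@sb_inv B) (@sb_circ B).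
Proof. exact: group_opVr circG. Qed.
Lemma sb_circI a : injective (fun x => a ∘ x).
Proof.
by move=> x y /(congr1 (fun t => sb_inv a ∘ t)); rewrite !sb_circA sb_circV !sb_circ1.
Qed.

Lemma sb_circ0 a : a ∘ sb_zero B = a.
Proof.
have h := sb_brace a (sb_zero B) (sb_zero B); rewrite sb_add0 in h.
by apply/sb_sub_eq0/(@sb_addIr (a ∘ sb_zero B)); rewrite -h sb_add0.
Qed.

Lemma sb_one0 : sb_one B = sb_zero B.
Proof. by rewrite -(sb_circ0 (sb_one B)) sb_circ1. Qed.

Lemma sb_lambdaD a x y : sb_lambda a (x + y) = sb_lambda a x + sb_lambda a y.
Proof. by rewrite /sb_lambda sb_brace !sb_word. Qed.

Lemma sb_lambda0 a : sb_lambda a (sb_zero B) = sb_zero B.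
Proof. by rewrite /sb_lambda sb_circ0 sb_addN. Qed.

Lemma sb_lambdaN a x : sb_lambda a (- x) = - sb_lambda a x.
Proof.
apply: (@sb_addIr (sb_lambda a x)).
by rewrite -sb_lambdaD !sb_addN sb_lambda0.
Qed.

Lemma sb_lambdaM a b x : sb_lambda (a ∘ b) x = sb_lambda a (sb_lambda b x).
Proof.
by rewrite [sb_lambda b x]/sb_lambda sb_lambdaD sb_lambdaN /sb_lambda sb_circA !sb_word.
Qed.

Lemma sb_lambda1 x : sb_lambda (sb_one B) x = x.
Proof. by rewrite /sb_lambda sb_circ1 sb_one0 sb_opp0 sb_add0. Qed.

Lemma sb_lambdaVK a : cancel (sb_lambda (sb_inv a)) (sb_lambda a).
Proof. by move=> x; rewrite -sb_lambdaM sb_circrV sb_lambda1. Qed.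

Lemma sb_circE a b : a ∘ b = a + sb_lambda a b.
Proof. by rewrite /sb_lambda !sb_word. Qed.

Lemma sb_circB a x y : a ∘ (x + - y) = a ∘ x + - (a ∘ y) + a.
Proof. by rewrite !sb_circE sb_lambdaD sb_lambdaN !sb_word. Qed.

(** * Gaps and an abelian ideal with trivial quotient *)

Hypothesis circC : commutative_skew_brace B.

Lemma sb_lambdaC a b x :
  sb_lambda a (sb_lambda b x) = sb_lambda b (sb_lambda a x).
Proof. by rewrite -!sb_lambdaM circC. Qed.

(** The commutator of (a,0) and (0,b) in the semidirect product of (B,+) by (B,∘) acting through
    λ. *)
Definition sb_gap a b : B := a + - sb_lambda b a.

(** The action of (a,a) on (B,+) by conjugation in the same semidirect product. *)
Definition sb_rho a x : B := a ∘ x + - a.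

Lemma sb_rhoE a x : sb_rho a x = a + sb_lambda a x + - a.
Proof. by rewrite /sb_rho sb_circE. Qed.

Lemma sb_lambda_gap c a b : sb_lambda c (sb_gap a b) = sb_gap (sb_lambda c a) b.
Proof. by rewrite /sb_gap sb_lambdaD sb_lambdaN sb_lambdaC. Qed.

Lemma sb_rho_gap c a b : sb_rho c (sb_gap a b) = sb_gap a (sb_rho c b).
Proof.
have gapE x y : sb_gap x y = x + - (x ∘ y) + y.
  by rewrite /sb_gap circC /sb_lambda !sb_word.
have circD x y z : x ∘ (- y + z) = x + - (x ∘ y) + x ∘ z.
  by rewrite !sb_circE sb_lambdaD sb_lambdaN !sb_word.
rewrite /sb_rho gapE; have -> : a + - (a ∘ b) + b = a + - (- b + a ∘ b).
  by rewrite !sb_word.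
rewrite sb_circB circD gapE sb_circB sb_circA [c ∘ a]circC.
by rewrite -sb_circA !sb_word.
Qed.

(* Itô's argument for the product of the two abelian subgroups
   {(0,a)} and {(a,a)} of the semidirect product of (B,+) by (B,∘). *)
Lemma sb_gapC a b c d : sb_gap a b + sb_gap c d = sb_gap c d + sb_gap a b.
Proof.
pose e := - a; pose x := sb_gap (sb_lambda (sb_inv (b ∘ e)) c) d.
have xE : sb_lambda (b ∘ e) x = sb_gap c d.
  by rewrite /x sb_lambda_gap sb_lambdaVK.
(* The two sides are the conjugates of [sb_gap c d] by [sb_lambda b e] and by [e]; so
   [- e + sb_lambda b e], which is [sb_gap a b], commutes with it. *)
have : sb_lambda b (sb_rho e x) = sb_rho e (sb_lambda b x).
  by rewrite /x sb_rho_gap !sb_lambda_gap sb_rho_gap.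
rewrite !sb_rhoE (sb_lambdaD b (e + _)) (sb_lambdaD b e) sb_lambdaN.
rewrite -!sb_lambdaM (circC e b) xE => h.
have -> : sb_gap a b = - e + sb_lambda b e.
  by rewrite /e sb_lambdaN sb_oppK.
apply: (@sb_addIr (- sb_lambda b e)); apply: (@sb_addrI e).
by move: h; rewrite !sb_word.
Qed.

(* The double centralizer of the gaps: a convenient abelian ideal with trivial
   quotient. *)
Definition gap_cent : set B :=
  [set x | forall a b, x + sb_gap a b = sb_gap a b + x].
Definition gap_core : set B :=
  [set x | forall y, gap_cent y -> x + y = y + x].

Lemma gap_core_gap a b : gap_core (sb_gap a b).
Proof. by move=> y ->. Qed.

Lemma gap_coreC x y : gap_core x -> gap_core y -> x + y = y + x.
Proof.
by move=> hx hy; apply: hx => a b; apply: hy => c d; apply: sb_gapC.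
Qed.

Lemma gap_core0 : gap_core (sb_zero B).
Proof. by move=> y _; rewrite !sb_word. Qed.

Lemma gap_coreD x y : gap_core x -> gap_core y -> gap_core (x + y).
Proof. by move=> hx hy z hz; rewrite -sb_addA hy // sb_addA hx // sb_addA. Qed.

Lemma gap_coreN x : gap_core x -> gap_core (- x).
Proof.
move=> hx z hz; apply: (@sb_addrI x); apply: (@sb_addIr x).
by rewrite !sb_word; rewrite -hx // !sb_word.
Qed.

(** Conjugation by [c] is ρ_c after λ_c^-1; on gaps, λ moves the first argument and ρ the second. *)
Lemma sb_gap_conj c a b : exists a' b', c + sb_gap a b + - c = sb_gap a' b'.
Proof.
exists (sb_lambda (sb_inv c) a), (sb_rho c b).
by rewrite -sb_rho_gap sb_rhoE -sb_lambda_gap sb_lambdaVK.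
Qed.

Lemma gap_cent_conj c x : gap_cent x -> gap_cent (c + x + - c).
Proof.
move=> hx a b; have [a' [b' h]] := sb_gap_conj (- c) a b.
rewrite sb_oppK in h.
apply: (@sb_addrI (- c)); apply: (@sb_addIr c); rewrite !sb_word.
by have := hx a' b'; rewrite -h !sb_word.
Qed.

Lemma gap_core_conj c x : gap_core x -> gap_core (c + x + - c).
Proof.
move=> hx y /(gap_cent_conj (- c)) /hx; rewrite sb_oppK => h.
apply: (@sb_addrI (- c)); apply: (@sb_addIr c).
by move: h; rewrite !sb_word.
Qed.

(** * Congruence modulo the core *)

Definition core_eq x y := gap_core (x + - y).

Lemma core_eq_refl x : core_eq x x.
Proof. by rewrite /core_eq sb_subrr; apply: gap_core0. Qed.

Lemma core_eq_sym x y : core_eq x y -> core_eq y x.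
Proof. by move=> /gap_coreN; rewrite /core_eq !sb_word. Qed.

Lemma core_eq_trans y x z : core_eq x y -> core_eq y z -> core_eq x z.
Proof. by move=> h k; have := gap_coreD h k; rewrite /core_eq !sb_word. Qed.

Lemma core_eqD x x' y y' : core_eq x x' -> core_eq y y' ->
  core_eq (x + y) (x' + y').
Proof.
move=> h k; apply: (core_eq_trans (y := x + y')).
  by have := gap_core_conj x k; rewrite /core_eq !sb_word.
by move: h; rewrite /core_eq !sb_word.
Qed.

Lemma core_eq_lambda a x : core_eq x (sb_lambda a x).
Proof. exact: gap_core_gap. Qed.

Lemma core_eq_circ a b : core_eq (a ∘ b) (a + b).
Proof.
rewrite sb_circE; apply/core_eqD/core_eq_sym/core_eq_lambda.
exact: core_eq_refl.
Qed.

(** Modulo the core, addition agrees with the commutative operation ∘. *)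
Lemma core_eqC a b : core_eq (a + b) (b + a).
Proof.
apply: core_eq_trans (core_eq_circ b a); rewrite circC.
exact/core_eq_sym/core_eq_circ.
Qed.

Lemma core_eqN x y : core_eq x y -> core_eq (- x) (- y).
Proof.
move=> h; have := gap_core_conj (- y) (core_eq_sym h).
have := gap_core_conj (- x) (core_eq_sym h).
by rewrite /core_eq !sb_word.
Qed.

End SkewBraceTheory.

(** * Ring expressions *)

Section RingExpressions.
Local Open Scope ring_scope.

(** Integral polynomials kept as syntax, so that a single expression can be evaluated in every
    commutative ring. *)
Inductive ring_expr (T : Type) : Type :=
| EVar of T
| EOne
| EOpp of ring_expr T
| EAdd of ring_expr T & ring_expr T
| EMul of ring_expr T & ring_expr T.

Fixpoint eeval (T : Type) (R : comNzRingType) (v : T -> R)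
    (E : ring_expr T) : R :=
  match E with
  | EVar x => v x
  | EOne => 1
  | EOpp E1 => - eeval v E1
  | EAdd E1 E2 => eeval v E1 + eeval v E2
  | EMul E1 E2 => eeval v E1 * eeval v E2
  end.

Fixpoint evars (T : Type) (E : ring_expr T) : seq T :=
  match E with
  | EVar x => [:: x]
  | EOne => [::]
  | EOpp E1 => evars E1
  | EAdd E1 E2 | EMul E1 E2 => evars E1 ++ evars E2
  end.

Lemma eeval_rmorph (T : Type) (R S : comNzRingType) (f : {rmorphism R -> S})
    (v : T -> R) E : f (eeval v E) = eeval (f \o v) E.
Proof.
elim: E => [x||E IH|E IH E' IH'|E IH E' IH'] //=.
- exact: rmorph1.
- by rewrite rmorphN IH.
- by rewrite rmorphD IH IH'.
- by rewrite rmorphM IH IH'.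
Qed.

Lemma eq_in_eeval (T : eqType) (R : comNzRingType) (v v' : T -> R) E :
  {in evars E, v =1 v'} -> eeval v E = eeval v' E.
Proof.
elim: E => [x||E IH|E IH E' IH'|E IH E' IH'] //= h.
- by rewrite h ?inE.
- by rewrite IH.
- by rewrite IH ?IH' // => x hx; apply: h; rewrite mem_cat hx ?orbT.
- by rewrite IH ?IH' // => x hx; apply: h; rewrite mem_cat hx ?orbT.
Qed.

Lemma poly_odd_roots (D : idomainType) (p : {poly D}) :
  injective (fun n : nat => n%:R : D) ->
  (forall k, p.[(k.*2.+1)%:R] = 0) -> p = 0.
Proof.
move=> inj hp; apply/eqP; case: (eqVneq p 0) => // p0.
pose rs := [seq (k.*2.+1)%:R : D | k <- iota 0 (size p)].
have := max_poly_roots p0 (rs := rs).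
rewrite size_map size_iota ltnn => -> //.
- by apply/allP => _ /mapP[k _ ->]; rewrite /root hp.
- rewrite map_inj_uniq ?iota_uniq // => i j /inj [].
  exact: double_inj.
Qed.

(* Induction on the variables: each one is replaced in turn by the
   indeterminate of a polynomial ring, where it has infinitely many
   specializations at which the expression vanishes. *)
Lemma eeval_odd_eq0_rec (T : eqType) (L : seq T) (D : idomainType)
    (R : comNzRingType) (f : {rmorphism D -> R}) (v0 : T -> D) E :
  injective (fun n : nat => n%:R : D) ->
  (forall v, (forall x, x \notin L -> v x = v0 x) ->
     (forall x, x \in L -> exists k, v x = (k.*2.+1)%:R) -> eeval v E = 0) ->
  forall r : T -> R, (forall x, x \notin L -> r x = f (v0 x)) -> eeval r E = 0.
Proof.
elim: L D f v0 => [|x L IH] D f v0 inj hE r hr.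
  have -> : r = f \o v0 by apply: funext => x; apply: hr.
  by rewrite -eeval_rmorph hE ?rmorph0.
(* The morphism from [{poly D}] to [R] extends [f] and sends 'X to [r x], so [r] at [x] also becomes
   an image. *)
have cfu : commr_rmorph f (r x) by move=> y; apply: mulrC.
pose v0' y := if y == x then 'X else (v0 y)%:P.
apply: (IH {poly D} (horner_morph cfu) v0') => [i j|v hv hvL|y hy].
- by rewrite -!polyC_natr => /polyC_inj/inj.
- apply: poly_odd_roots => // k; rewrite -[_.[_]]/(horner_eval _ _).
  rewrite eeval_rmorph; apply: hE => y; rewrite inE /= /horner_eval.
    rewrite negb_or => /andP[/negPf yx yL].
    by rewrite hv // /v0' yx hornerC.
  case: (boolP (y \in L)) => [/hvL[j ->] _|yL].
    by exists j; rewrite -polyC_natr hornerC.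
  by rewrite orbF hv // /v0' => ->; exists k; rewrite hornerX.
- rewrite /v0'; case: eqP => [->|/eqP yx]; first by rewrite /= horner_morphX.
  by rewrite /= horner_morphC hr // inE negb_or yx.
Qed.

Lemma eeval_odd_eq0 (T : Type) (E : ring_expr T) :
  (forall k : T -> nat, eeval (fun x => (k x).*2.+1%:R : int) E = 0) ->
  forall (R : comNzRingType) (r : T -> R), eeval r E = 0.
Proof.
move=> hE R r; pose T' : eqType := HB.pack T (gen_eqMixin T).
(* Only finitely many variables occur. The others get the value 1, the image of an odd integer. *)
pose L : seq T' := evars E; pose r' (x : T') := if x \in L then r x else 1.
have -> : eeval r E = eeval r' E.
  by apply: (@eq_in_eeval T') => x hx; rewrite /r' hx.
apply: (@eeval_odd_eq0_rec T' L int R intr (fun=> 1)).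
- by move=> i j /eqP; rewrite eqr_nat => /eqP.
- move=> v hv hvL.
  have {hv hvL} : forall x : T', exists k, v x = k.*2.+1%:R.
    move=> x; case: (boolP (x \in L)) => [/hvL //|/hv ->].
    by exists 0%N.
  by move=> /choice[k hk]; have -> := funext hk; apply: hE.
- by move=> x /negPf hx; rewrite /r' hx rmorph1.
Qed.

End RingExpressions.

(** * Bicommutants *)

Section Bicommutant.
Local Open Scope ring_scope.
Variables (W : zmodType) (I : Type) (S : I -> W -> W).
Hypothesis S_add : forall i, {morph S i : x y / x + y}.
Hypothesis S_comm : forall i j x, S i (S j x) = S j (S i x).
Variable w0 : W.
Hypothesis w0_neq0 : w0 <> 0.

Record bicommutant : Type := Bicommutant {
  bic_fun :> W -> W;
  bic_add : {morph bic_fun : x y / x + y};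
  bic_comm : forall g : W -> W, {morph g : x y / x + y} ->
    (forall i x, g (S i x) = S i (g x)) ->
    forall x, g (bic_fun x) = bic_fun (g x)
}.

Lemma bicP (p q : bicommutant) : p =1 q -> p = q.
Proof.
case: p q => [p p1 p2] [q q1 q2] /= /funext pq; case: q / pq q1 q2 => q1 q2.
by congr Bicommutant.
Qed.

HB.instance Definition _ := gen_eqMixin bicommutant.
HB.instance Definition _ := gen_choiceMixin bicommutant.

Lemma morphD0 (g : W -> W) : {morph g : x y / x + y} -> g 0 = 0.
Proof. by move=> h; apply: (addIr (g 0)); rewrite -h !add0r. Qed.

Lemma morphDN (g : W -> W) : {morph g : x y / x + y} -> {morph g : x / - x}.
Proof.
by move=> h x; apply: (addIr (g x)); rewrite -h !addNr morphD0.
Qed.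

#[local] Obligation Tactic := idtac.

Program Definition bic0 : bicommutant := @Bicommutant (fun=> 0) _ _.
Next Obligation. by move=> x y; rewrite addr0. Qed.
Next Obligation. by move=> g hg _ _ /=; rewrite (morphD0 hg). Qed.
Program Definition bic1 : bicommutant := @Bicommutant id _ _.
Next Obligation. by []. Qed.
Next Obligation. by []. Qed.
Program Definition bicN (p : bicommutant) : bicommutant :=
  @Bicommutant (fun x => - p x) _ _.
Next Obligation. by move=> p x y; rewrite bic_add opprD. Qed.
Next Obligation. by move=> p g hg hc x /=; rewrite (morphDN hg) (bic_comm p hg hc). Qed.
Program Definition bicD (p q : bicommutant) : bicommutant :=
  @Bicommutant (fun x => p x + q x) _ _.
Next Obligation. by move=> p q x y; rewrite !bic_add addrACA. Qed.
Next Obligation. by move=> p q g hg hc x /=; rewrite hg !(bic_comm _ hg hc). Qed.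
Program Definition bicM (p q : bicommutant) : bicommutant :=
  @Bicommutant (p \o q) _ _.
Next Obligation. by move=> p q x y /=; rewrite !bic_add. Qed.
Next Obligation. by move=> p q g hg hc x /=; rewrite !(bic_comm _ hg hc). Qed.
Program Definition bic_of (i : I) : bicommutant := @Bicommutant (S i) _ _.
Next Obligation. by []. Qed.
Next Obligation. by []. Qed.

Lemma bicDA : associative bicD.
Proof. by move=> p q r; apply: bicP => x /=; rewrite addrA. Qed.
Lemma bicDC : commutative bicD.
Proof. by move=> p q; apply: bicP => x /=; rewrite addrC. Qed.
Lemma bicD0 : left_id bic0 bicD.
Proof. by move=> p; apply: bicP => x /=; rewrite add0r. Qed.
Lemma bicDN : left_inverse bic0 bicN bicD.
Proof. by move=> p; apply: bicP => x /=; rewrite addNr. Qed.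
HB.instance Definition _ := GRing.isZmodule.Build bicommutant
  bicDA bicDC bicD0 bicDN.

Lemma bicMA : associative bicM.
Proof. by move=> p q r; apply: bicP. Qed.
(** Each [S i] commutes with all [S j], hence with [p]; so [p] is itself one of the operators with
    which [q] must commute. *)
Lemma bicMC : commutative bicM.
Proof.
move=> p q; apply: bicP => x /=; rewrite (bic_comm q (bic_add p)) // => i y.
by rewrite (bic_comm p (S_add i)).
Qed.
Lemma bicM1 : left_id bic1 bicM.
Proof. by move=> p; apply: bicP. Qed.
Lemma bicMD : left_distributive bicM bicD.
Proof. by move=> p q r; apply: bicP. Qed.
Lemma bic1_neq0 : bic1 != 0.
Proof.
by apply/eqP => /(congr1 (fun p : bicommutant => p w0)) /= /w0_neq0.
Qed.
Definition bic_ring : comNzRingType := HB.pack bicommutant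
  (GRing.Zmodule_isComNzRing.Build bicommutant bicMA bicMC bicM1 bicMD bic1_neq0).

End Bicommutant.

(** * Affine representations *)

Section AffineRep.
Local Open Scope ring_scope.

(* In the coordinates [(m, u)] with [m = sigma - 1], additive sums become products in the affine
   group of [R], and circle products become (m + m' + m m', u u'). *)
Record affine_rep (B : skewBrace) (R : comNzRingType) (sigma u : B -> R) :
    Prop := AffineRep {
  rep_sigma0 : sigma (sb_zero B) = 1;
  rep_u0 : u (sb_zero B) = 1;
  rep_sigmaM : forall a b, sigma (sb_circ a b) = sigma a * sigma b;
  rep_uM : forall a b, u (sb_circ a b) = u a * u b;
  rep_sigmaD : forall a b, sigma (sb_add a b) = sigma a + u a * (sigma b - 1);
  rep_uD : forall a b, u (sb_add a b) = u a * u b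
}.

Definition rep_val (X : Type) (B : skewBrace) (i : X -> B) (R : comNzRingType)
    (sigma u : B -> R) (x : X + X) : R :=
  match x with inl x => sigma (i x) | inr x => u (i x) end.

Definition invertible (R : comNzRingType) (x : R) := exists y, y * x = 1.

Lemma invertibleM (R : comNzRingType) (x y : R) :
  invertible x -> invertible y -> invertible (x * y).
Proof. by move=> [z zx] [t ty]; exists (z * t); rewrite mulrACA zx ty mulr1. Qed.

(* The circle and additive operations act on (sigma, u) by rational functions,
   so (sigma w, u w) is a fraction P/H, E/G in the values at the generators,
   the same in all representations. *)
Definition rational (X : Type) (B : skewBrace) (i : X -> B) (w : B) :=
  exists P H E G : ring_expr (X + X), forall (R : comNzRingType) (sigma u : B -> R),
    affine_rep sigma u ->
    let v := rep_val i sigma u in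
    [/\ invertible (eeval v H), invertible (eeval v G),
        eeval v H * sigma w = eeval v P & eeval v G * u w = eeval v E].

Section RationalClosure.
Variables (X : Type) (B : skewBrace) (i : X -> B).
Let V x : ring_expr (X + X) := EVar x.
Let one : ring_expr (X + X) := EOne _.

Lemma invertible1 (R : comNzRingType) : invertible (1 : R).
Proof. by exists 1; rewrite mulr1. Qed.

Lemma rep_sigma_inv (R : comNzRingType) (sigma u : B -> R) a :
  affine_rep sigma u -> invertible (sigma a).
Proof.
move=> h; exists (sigma (sb_inv a)).
by rewrite -(rep_sigmaM h) sb_circV sb_one0 (rep_sigma0 h).
Qed.

Lemma rep_u_inv (R : comNzRingType) (sigma u : B -> R) a :
  affine_rep sigma u -> invertible (u a).
Proof.
move=> h; exists (u (sb_opp a)).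
by rewrite -(rep_uD h) sb_addN (rep_u0 h).
Qed.

Lemma rational_gen x : rational i (i x).
Proof.
exists (V (inl x)), one, (V (inr x)), one => R sigma u h /=.
by split; rewrite ?mul1r //; apply: invertible1.
Qed.

Lemma rational_zero : rational i (sb_zero B).
Proof.
exists one, one, one, one => R sigma u h /=.
by rewrite (rep_sigma0 h) (rep_u0 h) mulr1; split=> //; apply: invertible1.
Qed.

Lemma rational_circ a b : rational i a -> rational i b ->
  rational i (sb_circ a b).
Proof.
move=> [P [H [E [G hr]]]] [P' [H' [E' [G' hr']]]].
exists (EMul P P'), (EMul H H'), (EMul E E'), (EMul G G') => R sigma u h /=.
have [iH iG eP eE] := hr R sigma u h; have [iH' iG' eP' eE'] := hr' R sigma u h.
split; try exact: invertibleM.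
- by rewrite (rep_sigmaM h) mulrACA eP eP'.
- by rewrite (rep_uM h) mulrACA eE eE'.
Qed.

Lemma rational_add a b : rational i a -> rational i b ->
  rational i (sb_add a b).
Proof.
move=> [P [H [E [G hr]]]] [P' [H' [E' [G' hr']]]].
(* P/H + (E/G)(P'/H' - 1) over the common denominator H G H'. *)
exists (EAdd (EMul P (EMul G H')) (EAdd (EMul E (EMul H P'))
  (EOpp (EMul E (EMul H H'))))), (EMul H (EMul G H')),
  (EMul E E'), (EMul G G') => R sigma u h /=.
have [iH iG eP eE] := hr R sigma u h; have [iH' iG' eP' eE'] := hr' R sigma u h.
split; try by do ?apply: invertibleM.
- by rewrite (rep_sigmaD h) -eP -eE -eP'; ring.
- by rewrite (rep_uD h) mulrACA eE eE'.
Qed.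

Lemma rational_opp a : rational i a -> rational i (sb_opp a).
Proof.
move=> [P [H [E [G hr]]]].
(* Solving [rep_sigmaD] at a + (- a) = 0 gives sigma(- a) = (u a - sigma a + 1) / u a, here with the
   fractions cleared. *)
exists (EAdd (EMul E H) (EAdd (EOpp (EMul P G)) (EMul H G))),
  (EMul E H), G, E => R sigma u h /=.
have [iH iG eP eE] := hr R sigma u h.
have iE : invertible (eeval (rep_val i sigma u) E).
  by rewrite -eE; apply: invertibleM => //; apply: rep_u_inv h.
have u1 : u a * u (sb_opp a) = 1 by rewrite -(rep_uD h) sb_subrr (rep_u0 h).
have s1 : u a * sigma (sb_opp a) = 1 - sigma a + u a.
  by rewrite -(rep_sigma0 h) -(sb_subrr a) (rep_sigmaD h); ring.
split=> //; first exact: invertibleM.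
- rewrite -eP -eE.
  have rearrange (g k x y : R) : g * x * k * y = g * k * (x * y) by ring.
  by rewrite rearrange s1; ring.
- by rewrite -eE -mulrA u1 mulr1.
Qed.

Lemma rational_inv a : rational i a -> rational i (sb_inv a).
Proof.
move=> [P [H [E [G hr]]]]; exists H, P, G, E => R sigma u h /=.
have [iH iG eP eE] := hr R sigma u h.
split.
- by rewrite -eP; apply: invertibleM => //; apply: rep_sigma_inv h.
- by rewrite -eE; apply: invertibleM => //; apply: rep_u_inv h.
- by rewrite -eP -mulrA -(rep_sigmaM h) sb_circrV sb_one0 (rep_sigma0 h) mulr1.
- by rewrite -eE -mulrA -(rep_uM h) sb_circrV sb_one0 (rep_u0 h) mulr1.
Qed.

End RationalClosure.
End AffineRep.

(** * Generation of the free object *)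

Section Subbrace.
Variables (B : skewBrace) (P : set B).
Hypotheses (P0 : P (sb_zero B)) (PD : forall x y, P x -> P y -> P (sb_add x y))
  (PN : forall x, P x -> P (sb_opp x))
  (PM : forall x y, P x -> P y -> P (sb_circ x y))
  (PV : forall x, P x -> P (sb_inv x)).

Let T := {x : B | P x}.
Let valI (x y : T) : sval x = sval y -> x = y.
Proof. exact: eq_sig_hprop. Qed.

Let addT (x y : T) : T := exist _ _ (PD (svalP x) (svalP y)).
Let oppT (x : T) : T := exist _ _ (PN (svalP x)).
Let circT (x y : T) : T := exist _ _ (PM (svalP x) (svalP y)).
Let invT (x : T) : T := exist _ _ (PV (svalP x)).
Let zeroT : T := exist _ _ P0.

Fact subbrace_add : group_laws addT zeroT oppT.
Proof.
split=> [x y z|x|x|x|x]; apply: valI => /=; by rewrite ?sb_word.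
Qed.

Fact subbrace_circ : group_laws circT zeroT invT.
Proof.
split=> [x y z|x|x|x|x]; apply: valI => /=; rewrite -?sb_one0.
- exact: sb_circA.
- exact: sb_circ1.
- exact: sb_circr1.
- exact: sb_circV.
- exact: sb_circrV.
Qed.

Fact subbrace_brace (a b c : T) :
  circT a (addT b c) = addT (addT (circT a b) (oppT a)) (circT a c).
Proof. by apply: valI; apply: sb_brace. Qed.

Definition subbrace : skewBrace :=
  SkewBrace subbrace_add subbrace_circ subbrace_brace.

Lemma subbrace_commutative :
  commutative_skew_brace B -> commutative_skew_brace subbrace.
Proof. by move=> h x y; apply: valI; apply: h. Qed.

End Subbrace.

(** The elements satisfying [P] form a commutative skew brace containing the image of [i]. The
    induced map into it, followed by the inclusion, fixes [i], so by uniqueness it is the identity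
    of [B]. *)
Lemma free_brace_ind (X : Type) (B : skewBrace) (i : X -> B) (P : set B) :
  is_free_commutative_skew_brace i ->
  (forall x, P (i x)) -> P (sb_zero B) ->
  (forall x y, P x -> P y -> P (sb_add x y)) ->
  (forall x, P x -> P (sb_opp x)) ->
  (forall x y, P x -> P y -> P (sb_circ x y)) ->
  (forall x, P x -> P (sb_inv x)) ->
  forall x, P x.
Proof.
move=> [BC free] Pi P0 PD PN PM PV x.
pose K := subbrace P0 PD PN PM PV.
have [phi [[phi_hom phi_i] _]] := free K (subbrace_commutative BC)
  (fun x => exist _ _ (Pi x)).
have [psi [_ psi_uniq]] := free B BC i.
have <- : sval (phi x) = x; last exact: (svalP (phi x)).
have h1 : psi = (fun x => sval (phi x)).
  apply: psi_uniq; split; last first.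
    by apply: funext => y /=; have /(congr1 (fun g => sval (g y))) := phi_i.
  split=> y z; first by rewrite (sb_hom_add phi_hom).
  by rewrite (sb_hom_circ phi_hom).
have h2 : psi = id by apply: psi_uniq.
by have := congr1 (fun g => g x) h1; rewrite /= h2.
Qed.

(** * Finite models *)

Section UnitBrace.
Local Open Scope ring_scope.
Variable R : comUnitRingType.
Hypothesis unitD3 : forall x y z : R, x \is a GRing.unit ->
  y \is a GRing.unit -> z \is a GRing.unit -> x + y + z \is a GRing.unit.

Definition unit_pair : Type :=
  {x : R * R | (x.1 \is a GRing.unit) && (x.2 \is a GRing.unit)}.

(** The first coordinate s + u s' - u is a sum of three units, whence the hypothesis [unitD3]. *)
Lemma upair_add_subproof (x y : unit_pair) :
  ((val x).1 + (val x).2 * ((val y).1 - 1) \is a GRing.unit) &&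
  ((val x).2 * (val y).2 \is a GRing.unit).
Proof.
case: x y => [[s u] /= /andP[us uu]] [[s' u'] /= /andP[us' uu']].
by rewrite mulrBr mulr1 addrA unitD3 ?unitrM ?unitrN ?us' ?uu ?uu'.
Qed.

Lemma upair_opp_subproof (x : unit_pair) :
  (1 - (val x).2^-1 * ((val x).1 - 1) \is a GRing.unit) &&
  ((val x).2^-1 \is a GRing.unit).
Proof.
case: x => [[s u] /= /andP[us uu]].
by rewrite mulrBr mulr1 opprB addrA (addrC 1) addrAC -addrA addrC addrAC
  unitD3 ?unitrN ?unitrM ?unitrV ?unitr1 ?us ?uu.
Qed.

Lemma upair_circ_subproof (x y : unit_pair) :
  ((val x).1 * (val y).1 \is a GRing.unit) &&
  ((val x).2 * (val y).2 \is a GRing.unit).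
Proof.
case: x y => [[s u] /= /andP[us uu]] [[s' u'] /= /andP[us' uu']].
by rewrite !unitrM us us' uu uu'.
Qed.

Lemma upair_inv_subproof (x : unit_pair) :
  ((val x).1^-1 \is a GRing.unit) && ((val x).2^-1 \is a GRing.unit).
Proof. by rewrite !unitrV (valP x). Qed.

Lemma upair_one_subproof :
  ((1 : R, 1 : R).1 \is a GRing.unit) && ((1 : R, 1 : R).2 \is a GRing.unit).
Proof. by rewrite !unitr1. Qed.

Definition upair_add x y : unit_pair := exist _ (_, _) (upair_add_subproof x y).
Definition upair_opp x : unit_pair := exist _ (_, _) (upair_opp_subproof x).
Definition upair_circ x y : unit_pair := exist _ (_, _) (upair_circ_subproof x y).
Definition upair_inv x : unit_pair := exist _ (_, _) (upair_inv_subproof x).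
Definition upair_one : unit_pair := exist _ (_, _) upair_one_subproof.

Fact upair_add_group : group_laws upair_add upair_one upair_opp.
Proof.
split=> [x y z|x|x|x|x]; apply: val_inj => /=.
- by congr pair; ring.
- by rewrite (surjective_pairing (val x)) /=; congr pair; ring.
- by rewrite [RHS](surjective_pairing (val x)) /=; congr pair; ring.
- case: x => [[s u] /= /andP[us uu]]; congr pair; last exact: mulVr.
  by ring.
- case: x => [[s u] /= /andP[us uu]]; congr pair; last exact: mulrV.
  by rewrite addrAC subrr add0r mulrN mulrA mulrV // mul1r; ring.
Qed.

Fact upair_circ_group : group_laws upair_circ upair_one upair_inv.
Proof.
split=> [x y z|x|x|x|x]; apply: val_inj => /=.
- by rewrite !mulrA.
- by rewrite !mul1r -surjective_pairing.
- by rewrite !mulr1 -surjective_pairing.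
- by have /andP[us uu] := valP x; rewrite !mulVr.
- by have /andP[us uu] := valP x; rewrite !mulrV.
Qed.

Fact upair_brace a b c : upair_circ a (upair_add b c) =
  upair_add (upair_add (upair_circ a b) (upair_opp a)) (upair_circ a c).
Proof.
case: a b c => [[s u] ha] [[s' u'] hb] [[t v] hc].
have /andP[/= us uu] := ha.
apply: val_inj => /=; congr pair; last first.
  by rewrite -!mulrA [u^-1 * _]mulrA mulVr // mul1r mulrCA.
have h x : u * u' * (1 - u^-1 * x - 1) = - u' * x.
  by rewrite addrAC subrr add0r mulrN (mulrC u) -mulrA (mulrA u) mulrV ?mul1r // mulNr.
by rewrite h (mulrAC u) mulrV // mul1r; ring.
Qed.

Definition unit_brace : skewBrace :=
  SkewBrace upair_add_group upair_circ_group upair_brace.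

Lemma unit_brace_commutative : commutative_skew_brace unit_brace.
Proof.
by move=> x y; apply: val_inj => /=; rewrite mulrC [_.2 * _]mulrC.
Qed.

End UnitBrace.

(** * The faithful affine representation *)

Section FaithfulRep.
Local Open Scope ring_scope.
Variable B : skewBrace.
Hypothesis circC : commutative_skew_brace B.

(** The argument ties the type to the proof on which commutativity of its addition rests, so that
    instances can be attached to it. *)
Definition core_group (_ : commutative_skew_brace B) : Type :=
  {x : B | gap_core x}.

Local Notation M := (core_group circC).

Lemma core_groupP (x y : M) : sval x = sval y -> x = y.
Proof. exact: eq_sig_hprop. Qed.

Definition coreD (x y : M) : M := exist _ _ (gap_coreD (svalP x) (svalP y)).
Definition coreN (x : M) : M := exist _ _ (gap_coreN (svalP x)).
Definition core0 : M := exist _ _ (@gap_core0 B).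

Fact coreDA : associative coreD.
Proof. by move=> x y z; apply: core_groupP; apply: sb_addA. Qed.
Fact coreDC : commutative coreD.
Proof.
by move=> x y; apply: core_groupP; apply: (gap_coreC circC); apply: svalP.
Qed.
Fact core0D : left_id core0 coreD.
Proof. by move=> x; apply: core_groupP; apply: sb_add0. Qed.
Fact coreND : left_inverse core0 coreN coreD.
Proof. by move=> x; apply: core_groupP; apply: sb_addN. Qed.

HB.instance Definition _ := gen_eqMixin M.
HB.instance Definition _ := gen_choiceMixin M.
HB.instance Definition _ := GRing.isZmodule.Build M coreDA coreDC core0D coreND.

(** * Functions of pairs, their shifts and two test functions *)

Let V : zmodType := (M * int)%type.

(* The relation [affine_fun_add] says that the shifts below satisfy
   [rep_sigmaD]. The factor [int] of [V] only serves to make the functions of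
   [y] alone separate the classes modulo the core. *)
Record affine_fun : Type := AffineFun {
  afun :> B -> B -> V;
  affine_fun_core : forall a y y', core_eq y y' -> afun a y = afun a y';
  affine_fun_add : forall a b c y,
    afun (sb_circ a (sb_add b c)) (sb_add y c) =
    afun (sb_circ a b) y + afun (sb_circ a c) (sb_add y c) - afun a y
}.

Lemma affine_funP (f g : affine_fun) : (forall a y, f a y = g a y) -> f = g.
Proof.
case: f g => [f f1 f2] [g g1 g2] /= fg.
have {}fg : f = g by apply: funext => a; apply: funext => y.
by case: g / fg g1 g2 => g1 g2; congr AffineFun.
Qed.

HB.instance Definition _ := gen_eqMixin affine_fun.
HB.instance Definition _ := gen_choiceMixin affine_fun.

#[local] Obligation Tactic := idtac.

Program Definition afun0 := @AffineFun (fun _ _ => 0) _ _.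
Next Obligation. by []. Qed.
Next Obligation. by move=> *; rewrite addr0 subr0. Qed.
Program Definition afunN (f : affine_fun) := @AffineFun (fun a y => - f a y) _ _.
Next Obligation. by move=> f a y y' /(affine_fun_core f) ->. Qed.
Next Obligation. by move=> f a b c y /=; rewrite affine_fun_add !opprD. Qed.
Program Definition afunD (f g : affine_fun) :=
  @AffineFun (fun a y => f a y + g a y) _ _.
Next Obligation.
by move=> f g a y y' h /=; rewrite (affine_fun_core f a h) (affine_fun_core g a h).
Qed.
Next Obligation.
move=> f g a b c y /=; rewrite !affine_fun_add opprD.
by rewrite [LHS]addrACA [X in X + _ = _]addrACA.
Qed.

Fact afunDA : associative afunD.
Proof. by move=> f g h; apply: affine_funP => a y; apply: addrA. Qed.
Fact afunDC : commutative afunD.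
Proof. by move=> f g; apply: affine_funP => a y; apply: addrC. Qed.
Fact afun0D : left_id afun0 afunD.
Proof. by move=> f; apply: affine_funP => a y; apply: add0r. Qed.
Fact afunND : left_inverse afun0 afunN afunD.
Proof. by move=> f; apply: affine_funP => a y; apply: addNr. Qed.

HB.instance Definition _ := GRing.isZmodule.Build affine_fun
  afunDA afunDC afun0D afunND.

Program Definition shift (p : B * B) (f : affine_fun) :=
  @AffineFun (fun a y => f (sb_circ a p.1) (sb_add y p.2)) _ _.
Next Obligation.
move=> p f a y y' h; apply: affine_fun_core.
by apply: (core_eqD circC) => //; apply: core_eq_refl.
Qed.
Next Obligation.
move=> [b e] f a c d y /=.
have h : core_eq (sb_add (sb_add y d) e) (sb_add (sb_add y e) d).
  rewrite -!sb_addA; apply: (core_eqD circC); first exact: core_eq_refl.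
  exact: core_eqC.
have circAC x z : sb_circ (sb_circ x z) b = sb_circ (sb_circ x b) z.
  by rewrite -!sb_circA (circC z).
by rewrite !circAC !(affine_fun_core f _ h) affine_fun_add.
Qed.

Lemma shiftD p : {morph shift p : f g / f + g}.
Proof. by move=> f g; apply: affine_funP. Qed.

Lemma shiftC p q f : shift p (shift q f) = shift q (shift p f).
Proof.
apply: affine_funP => a y /=; rewrite -!sb_circA (circC p.1) -!sb_addA.
apply: affine_fun_core; apply: (core_eqD circC); first exact: core_eq_refl.
exact: core_eqC.
Qed.

Definition core_indicator (y : B) : V := (0, if `[< gap_core y >] then 1 else 0).

Program Definition core_indicator_fun :=
  @AffineFun (fun _ y => core_indicator y) _ _.
Next Obligation.
move=> a y y' h; rewrite /core_indicator; suff -> : gap_core y = gap_core y' by [].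
apply: propext; have h0 z : gap_core z <-> core_eq z (sb_zero B).
  by rewrite /core_eq !sb_word.
rewrite !h0; split; last exact: core_eq_trans.
exact/core_eq_trans/core_eq_sym.
Qed.
Next Obligation. by move=> a b c y /=; rewrite addrAC subrr add0r. Qed.

Lemma core_indicator_neq0 : core_indicator_fun <> 0.
Proof.
move/(congr1 (fun f : affine_fun => (f (sb_zero B) (sb_zero B)).2)) => /=.
by rewrite asboolT //; apply: gap_core0.
Qed.

Definition core_repr (y : B) : B :=
  sval (cid (ex_intro (fun z => core_eq z y) y (core_eq_refl y))).

Lemma core_reprP y : core_eq (core_repr y) y.
Proof. by rewrite /core_repr; case: cid. Qed.

(** Congruent elements define the same predicate to choose from, hence get the same choice. *)
Lemma core_repr_eq y y' : core_eq y y' -> core_repr y = core_repr y'.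
Proof.
move=> h; rewrite /core_repr; move: (ex_intro _ y _) (ex_intro _ y' _).
suff -> : (fun z => core_eq z y) = (fun z => core_eq z y').
  by move=> p q; rewrite (Prop_irrelevance p q).
apply: funext => z; apply: propext; split=> k; apply: core_eq_trans k _ => //.
exact: core_eq_sym.
Qed.

Definition primitive_val (a y : B) : B :=
  sb_add (sb_add (core_repr (sb_add y (sb_opp a))) a) (sb_opp (core_repr y)).

Lemma primitive_val_core a y : gap_core (primitive_val a y).
Proof.
have h : core_eq (sb_add (core_repr (sb_add y (sb_opp a))) a) y.
  rewrite -[X in core_eq _ X](sb_addrNK y a).
  by apply: (core_eqD circC); [apply: core_reprP|apply: core_eq_refl].
exact: core_eq_trans h (core_eq_sym (core_reprP y)).
Qed.

(* A potential for the derivation b |-> [repr y + lambda_a b - repr (y + b)]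
   attached to the embedding of the extension (B,+) of B/core by the core. *)
Program Definition primitive := @AffineFun
  (fun a y => (exist _ _ (primitive_val_core a y) : M, 0)) _ _.
Next Obligation.
move=> a y y' h; congr pair; apply: core_groupP => /=.
rewrite /primitive_val (core_repr_eq h); congr (sb_add (sb_add _ _) _).
by apply: core_repr_eq; apply: (core_eqD circC) => //; apply: core_eq_refl.
Qed.
Next Obligation.
move=> a b c y /=; congr pair.
set p := exist _ _ (primitive_val_core _ y) : M.
set q := exist _ _ _ : M; set r := exist _ _ (primitive_val_core _ y) : M.
(* Reordered in the abelian core, the right side telescopes once representatives of congruent
   elements are identified; the brace identity remains. *)
rewrite [RHS]addrAC; apply: core_groupP; rewrite /= /primitive_val.
have -> : core_repr (sb_add (sb_add y c) (sb_opp (sb_circ a (sb_add b c)))) =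
          core_repr (sb_add y (sb_opp (sb_circ a b))).
  apply: core_repr_eq.
  have -> : sb_add y (sb_opp (sb_circ a b)) =
    sb_add (sb_add y c) (sb_opp (sb_add (sb_circ a b) c)) by rewrite !sb_word.
  apply: (core_eqD circC); first exact: core_eq_refl.
  apply: (core_eqN circC); rewrite sb_brace -sb_addA -/(sb_lambda a c).
  apply: (core_eqD circC); first exact: core_eq_refl.
  exact/core_eq_sym/core_eq_lambda.
have -> : core_repr (sb_add (sb_add y c) (sb_opp (sb_circ a c))) =
          core_repr (sb_add y (sb_opp a)).
  apply: core_repr_eq.
  have -> : sb_add y (sb_opp a) =
    sb_add (sb_add y c) (sb_opp (sb_add a c)) by rewrite !sb_word.
  apply: (core_eqD circC); first exact: core_eq_refl.
  exact/(core_eqN circC)/core_eq_circ.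
by rewrite sb_brace !sb_word.
Qed.

Definition brace_ring : comNzRingType :=
  bic_ring shiftD shiftC core_indicator_neq0.

Definition brace_sigma (b : B) : brace_ring := bic_of shiftD (b, b).
Definition brace_u (b : B) : brace_ring := bic_of shiftD (sb_one B, b).

(** The laws for ∘ hold because [y] matters only modulo the core, where ∘ and + agree; [rep_sigmaD]
    is the relation [affine_fun_add]. *)
Lemma brace_rep : affine_rep brace_sigma brace_u.
Proof.
have core_circ (y b c : B) :
    core_eq (sb_add y (sb_circ b c)) (sb_add (sb_add y b) c).
  rewrite -sb_addA; apply: (core_eqD circC); first exact: core_eq_refl.
  exact: core_eq_circ.
split=> [||b c|b c|b c|b c]; apply: bicP => f; apply: affine_funP => a y /=.
- by rewrite sb_addr0 sb_circ0.
- by rewrite sb_addr0 sb_circr1.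
- by rewrite (affine_fun_core f _ (core_circ _ _ _)) sb_circA.
- by rewrite (affine_fun_core f _ (core_circ _ _ _)) !sb_circr1.
- by rewrite sb_addA affine_fun_add !sb_circr1 addrA.
- by rewrite !sb_circr1 sb_addA.
Qed.

(** The shift [brace_u w] applied to the indicator at (0,0) tests whether [w] is in the core.
    Applied to [primitive] there, [brace_sigma w] yields the conjugate of [w] by [core_repr] of 0,
    which must then vanish. *)
Lemma brace_rep_faithful w : brace_sigma w = 1 -> brace_u w = 1 -> w = sb_zero B.
Proof.
move=> sw uw.
have hw : gap_core w.
  have /(congr1 (fun f : affine_fun => (f (sb_zero B) (sb_zero B)).2)) :=
    congr1 (fun p : bicommutant shift => p core_indicator_fun) uw.
  by rewrite /= sb_add0 (asboolT (@gap_core0 B)); case: asboolP.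
have w0 : core_eq w (sb_zero B) by rewrite /core_eq !sb_word.
have /(congr1 (fun f : affine_fun => sval (f (sb_zero B) (sb_zero B)).1)) :=
  congr1 (fun p : bicommutant shift => p primitive) sw.
have w1 : sb_circ (sb_zero B) w = w by rewrite -sb_one0 sb_circ1.
rewrite /= /primitive_val w1 !sb_word (core_repr_eq w0) => h.
apply: (@sb_addrI _ (core_repr (sb_zero B))).
apply: (@sb_addIr _ (sb_opp (core_repr (sb_zero B)))).
by rewrite h !sb_word.
Qed.

End FaithfulRep.

(** * Separation by finite models *)

Lemma sb_hom0 (B K : skewBrace) (phi : B -> K) :
  is_sb_hom phi -> phi (sb_zero B) = sb_zero K.
Proof.
move=> h; apply: (@sb_addIr _ (phi (sb_zero B))).
by rewrite -(sb_hom_add h) !sb_add0.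
Qed.

Lemma sb_homN (B K : skewBrace) (phi : B -> K) x :
  is_sb_hom phi -> phi (sb_opp x) = sb_opp (phi x).
Proof.
move=> h; apply: (@sb_addIr _ (phi x)).
by rewrite -(sb_hom_add h) !sb_addN sb_hom0.
Qed.

Lemma sb_homV (B K : skewBrace) (phi : B -> K) x :
  is_sb_hom phi -> phi (sb_inv x) = sb_inv (phi x).
Proof.
move=> h; apply: (@sb_circI _ (phi x)).
by rewrite -(sb_hom_circ h) !sb_circrV !sb_one0 sb_hom0.
Qed.

Lemma ker_ideal (B K : skewBrace) (phi : B -> K) :
  commutative_skew_brace B -> is_sb_hom phi ->
  is_ideal [set x | phi x = sb_zero K].
Proof.
move=> BC h.
have lam b x : phi x = sb_zero K -> phi (sb_lambda b x) = sb_zero K.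
  move=> hx; rewrite /sb_lambda (sb_hom_add h) (sb_hom_circ h) hx sb_circ0.
  by rewrite sb_homN // sb_addN.
split.
- split=> [|x y /= hx hy|x /= hx|g x /= hx].
  + exact: sb_hom0.
  + by rewrite (sb_hom_add h) hx hy sb_add0.
  + by rewrite sb_homN // hx sb_opp0.
  + by rewrite !(sb_hom_add h) hx sb_addr0 sb_homN // sb_subrr.
- split=> [|x y /= hx hy|x /= hx|g x /= hx].
  + by rewrite /= sb_one0 sb_hom0.
  + by rewrite (sb_hom_circ h) hx hy sb_circ0.
  + by rewrite sb_homV // hx -[RHS]sb_one0 -[LHS]sb_circ1 sb_one0 -sb_one0 sb_circrV.
  + by rewrite (BC g) -sb_circA sb_circrV sb_circr1.
- move=> b; apply/seteqP; split=> [_ [x /= hx <-]|x /= hx]; first exact: lam.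
  by exists (sb_lambda (sb_inv b) x); [apply: lam|apply: sb_lambdaVK].
Qed.

(** The cosets of the kernel are fibres of [phi]. *)
Lemma ker_finite_index (B K : skewBrace) (phi : B -> K) :
  is_sb_hom phi -> finite_set [set: K] ->
  finite_set (sb_quotient [set x | phi x = sb_zero K]).
Proof.
move=> h Kfin; pose F (k : K) := [set x | phi x = k].
apply: (sub_finite_set (B := F @` [set: K])); last exact: finite_image.
move=> _ [b _ <-]; exists (phi b) => //; apply/seteqP; split.
  move=> x /= hx; exists (sb_add (sb_opp b) x).
    by rewrite /= (sb_hom_add h) sb_homN // hx sb_addN.
  by rewrite /= !sb_word.
by move=> _ [x /= hx <-]; rewrite /F /= (sb_hom_add h) hx sb_addr0.
Qed.

(** * Units and integers modulo powers of two *)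

Section TwoPowers.
Local Open Scope ring_scope.
Variable n : nat.
Local Notation R := 'Z_(2 ^ n.+1).

Lemma two_power_gt1 : (1 < 2 ^ n.+1)%N.
Proof. by rewrite -{1}(expn0 2) ltn_exp2l. Qed.

Lemma unit_oddE k : (k%:R : R) \is a GRing.unit = odd k.
Proof. by rewrite unitZpE ?two_power_gt1 // coprime_pexpl // coprime2n. Qed.

Lemma unit_Z2D3 (x y z : R) : x \is a GRing.unit -> y \is a GRing.unit ->
  z \is a GRing.unit -> x + y + z \is a GRing.unit.
Proof.
rewrite -[x]natr_Zp -[y]natr_Zp -[z]natr_Zp -!natrD !unit_oddE !oddD.
by move=> -> -> ->.
Qed.

Lemma odd_unit k : (k.*2.+1%:R : R) \is a GRing.unit.
Proof. by rewrite unit_oddE /= odd_double. Qed.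

End TwoPowers.

Lemma int_eq0_mod_two_powers (z : int) :
  (forall n, (z%:~R : 'Z_(2 ^ n.+1)) = 0)%R -> z = 0%R.
Proof.
move=> h; apply/eqP; rewrite -absz_eq0; apply/eqP.
(* The exponent |z| + 1 makes the modulus exceed |z|. *)
have h0 : (`|z|%N%:R : 'Z_(2 ^ `|z|.+1))%R = 0%R.
  have := h `|z|%N; case: z {h} => m //=.
  by rewrite NegzE /= => /eqP; rewrite rmorphN oppr_eq0 => /eqP.
have := congr1 val h0; rewrite /= val_Zp_nat ?two_power_gt1 // modn_small //.
by apply: ltn_trans (ltn_expl _ _); rewrite // ltnS.
Qed.

Theorem proposition7p15 (X : Type) (X_nonempty : inhabited X)
    (B : skewBrace) (i : X -> B) (B_free : is_free_commutative_skew_brace i) :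
  residually_finite B.
Proof.
have [BC free] := B_free.
apply/seteqP; split=> [w hw|_ -> I [hI _]]; last exact: normal_1 (ideal_add hI).
have [P [H [E [G hr]]]] : rational i w.
  apply: (free_brace_ind B_free).
  - exact: rational_gen.
  - exact: rational_zero.
  - exact: rational_add.
  - exact: rational_opp.
  - exact: rational_circ.
  - exact: rational_inv.
have key (k : X + X -> nat) :
    let v x : int := ((k x).*2.+1%:R)%R in
    eeval v P = eeval v H /\ eeval v E = eeval v G.
  move=> v.
  suff main n : ((eeval v P)%:~R = (eeval v H)%:~R :> 'Z_(2 ^ n.+1))%R /\
                ((eeval v E)%:~R = (eeval v G)%:~R :> 'Z_(2 ^ n.+1))%R.
    split; apply/eqP; rewrite -subr_eq0; apply/eqP/int_eq0_mod_two_powers => n;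
      by have [h1 h2] := main n; rewrite intrB ?h1 ?h2 subrr.
  pose R : comUnitRingType := 'Z_(2 ^ n.+1).
  pose K := unit_brace (@unit_Z2D3 n).
  (* Freeness allows any odd values for the sigma and u of the generators. *)
  pose gen x : K := exist _ (((k (inl x)).*2.+1%:R)%R, ((k (inr x)).*2.+1%:R)%R)
    (introT andP (conj (odd_unit n _) (odd_unit n _))).
  have [phi [[phi_hom phi_i] _]] := free K (@unit_brace_commutative _ _) gen.
  have phiw : phi w = sb_zero K.
    apply: (hw [set x | phi x = sb_zero K]); split; first exact: ker_ideal.
    by apply: ker_finite_index => //; apply: finite_finset.
  pose sigma (b : B) : R := (sval (phi b)).1.
  pose u (b : B) : R := (sval (phi b)).2.
  have rep : affine_rep sigma u.
    split; rewrite /sigma /u ?(sb_hom0 phi_hom) // => a b.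
    - by rewrite (sb_hom_circ phi_hom).
    - by rewrite (sb_hom_circ phi_hom).
    - by rewrite (sb_hom_add phi_hom).
    - by rewrite (sb_hom_add phi_hom).
  have vE : rep_val i sigma u = (fun z : int => z%:~R : R)%R \o v.
    apply: funext => -[x|x]; rewrite /= /sigma /u;
      have /(congr1 (fun g => sval (g x))) /= <- := phi_i;
      by rewrite /= rmorph_nat.
  (* As [phi w] is zero, sigma w = u w = 1, so each numerator equals its denominator. *)
  have [_ _] := hr R sigma u rep.
  rewrite vE /sigma /u phiw /= !mulr1 -!(eeval_rmorph intr).
  by move=> -> ->.
have exprE (P1 P2 : ring_expr (X + X)) :
    (forall k : X + X -> nat, let v x : int := ((k x).*2.+1%:R)%R in
      eeval v P1 = eeval v P2) ->
    forall (R : comNzRingType) (r : X + X -> R), eeval r P1 = eeval r P2.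
  move=> h R r; apply/eqP; rewrite -subr_eq0; apply/eqP.
  apply: (@eeval_odd_eq0 _ (EAdd P1 (EOpp P2))) => k /=.
  by rewrite h subrr.
have inv_eq1 (R : comNzRingType) (h x : R) : invertible h ->
    (h * x)%R = h -> x = 1%R.
  by move=> [t th] hx; rewrite -[x]mul1r -th -mulrA hx.
(* In the faithful representation the denominators are invertible and now equal the numerators, so
   both coordinates of [w] are 1. *)
have [iH iG] := hr _ _ _ (brace_rep BC).
rewrite (exprE P H) => [|k]; last by have [] := key k.
rewrite (exprE E G) => [|k]; last by have [] := key k.
move=> /(inv_eq1 _ _ _ iH) sw /(inv_eq1 _ _ _ iG) uw.
exact: brace_rep_faithful sw uw.
Qed.
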